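(* Let $\nu\in\{0,1\}$ and let $b_{kl}^\star$ be any admissible solution of the generating equation for the system (S) of the context (all objects taken for $b_{kl}=b_{kl}^\star$, $\omega=\omega_{kl}$). For $\varepsilon\in(0,\varepsilon_*]$ ($\varepsilon_*>0$ sufficiently small) let $\rho=\Upsilon_\varepsilon^\nu(t,\varphi)$ be the invariant surface of the special polar system described in the context, determined by the function $A_\varepsilon^\nu$. Then $\Upsilon_\varepsilon^\nu$ has the asymptotic expansion $$\Upsilon_\varepsilon^0=\alpha^{-1}(\varphi)\Big((\overline g+\tilde g(t,\varphi))\varepsilon+\big(A^0_\varepsilon(t,\varphi)+\beta(\varphi)(\overline g+\tilde g(t,\varphi))^2+\tilde f(t,\varphi)\big)\varepsilon^2\Big)+O(\varepsilon^3)\quad(\nu=0),$$ $$\Upsilon_\varepsilon^1=\alpha^{-1}(\varphi)\Big((\overline g+\hat g(\varphi))\varepsilon+\big(A^1_\varepsilon(t,\varphi)+\beta(\varphi)(\overline g+\hat g(\varphi))^2+\hat f(\varphi)\big)\varepsilon^2\Big)+O(\varepsilon^3)\quad(\nu=1),$$ where $A_\varepsilon^\nu(t,\varphi)=O(1)$ in $\varepsilon$.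
   Context: **System (S).** Let $\gamma\in(0,1]$, $\nu\in\{0,1\}$, $T>0$, $\varepsilon_0>0$, $\sigma>\sqrt{1+\gamma^{-1/2}}$. The system is $$\dot x=\big(\gamma(y^3-y)+\varepsilon X^\nu(t,x,y,\varepsilon)\big)\varepsilon^\nu,\quad \dot y=\big(-(x^3-x)+\varepsilon Y^\nu(t,x,y,\varepsilon)\big)\varepsilon^\nu,\quad \varepsilon\in[0,\varepsilon_0],$$ with $X^\nu,Y^\nu$ continuous and $T$-periodic in $t$; $X^0=X^0_0(t,x,y)+X^0_1(t,x,y)\varepsilon+X^0_2(t,x,y,\varepsilon)\varepsilon^2$, $X^1=X^1_0(t,x,y)+X^1_1(t,x,y,\varepsilon)\varepsilon$, and similarly for $Y^\nu$. The functions $X_0^\nu,Y_0^\nu,X_1^0,Y_1^0$ are uniformly with respect to $t$ real-analytic in $x,y$ for $|x|,|y|<\sigma$, which means: each is continuous, $T$-periodic in $t$, and is the sum of a power series in $x,y$ with real continuous $T$-periodic coefficients that converges absolutely for every $t\in\mathbb R$ and all $|x|,|y|<\sigma$. The functions $X^\nu_{2-\nu},Y^\nu_{2-\nu}$ are of class $C^{0,1,1,\nu}_{t,x,y,\varepsilon}$ on $\{t\in\mathbb R,\ |x|,|y|\le\sigma,\ \varepsilon\in[0,\varepsilon_0]\}$ (continuous, with continuous first partial derivatives in $x,y$, and also in $\varepsilon$ if $\nu=1$). **Cycles.** Let $k,l\in\{0,\pm1\}$, $(k,l)\ne(0,\pm1)$. $(C(\varphi),S(\varphi))$ is the solution of $C'=\gamma(S^3-S)$,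 $S'=-(C^3-C)$ with $C(0)=b_{kl}$, $S(0)=l$. Put $r^i=\sqrt{1-(1-\gamma)^{1/2}}$, $r^e=\sqrt{1+(1-\gamma)^{1/2}}$, $r^s=\sqrt{1+\gamma^{1/2}}$, $r^\sigma=(1+(\gamma\sigma^2(\sigma^2-2))^{1/2})^{1/2}$. The allowed values are: (range) $b_{00}\in(0,r^i)$ or $b_{00}\in(r^e,r^\sigma)$; for $k=\pm1$: $0<\gamma\le0.8$ and $kb_{k0}\in(b_d,b_u)$ with $b_d=1.15-0.16(0.8-\gamma)^{1/2}$, $b_u=1.15+0.28(0.8-\gamma)^{1/2}$; for $k,l=\pm1$: $kb_{kl}\in(1,r^s)$. The solution is periodic; $\omega_{kl}$ is its period. **Functions on a cycle** (arguments $\varphi$; indices $kl$, and $\nu$ where obvious, are suppressed; prime is $\partial_\varphi$, dot is $\partial_t$). $\alpha=C'(S-l)-(C-k)S'$ (nowhere zero for allowed $b_{kl}$); $q=\alpha^{-2}((C-k)^3(2C+k)+\gamma(S-l)^3(2S+l))$; $p=3\gamma\alpha^{-1}CS((S^2-1)(C-k)^2-(C^2-1)(S-l)^2)$; $\beta(\varphi)=\int_0^\varphi\alpha^{-1}(\alpha'q-p)\,ds$ (periodic). With $X_0,Y_0$ and derivatives evaluated at $(t,C(\varphi),S(\varphi))$: $R^\circ=C'Y_0-S'X_0$; $\Phi^\circ=\alpha^{-1}((S-l)X_0-(C-k)Y_0)$; $P_r^\circ=\alpha^{-1}\big(C'((C-k)\partial_xY_0+(S-l)\partial_yY_0)-S'((C-k)\partial_xX_0+(S-l)\partial_yX_0)\big)$;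 $R_r^\circ=P_r^\circ+\alpha^{-1}\alpha'\Phi^\circ-2\beta R^\circ$; $R_\varepsilon^\circ=C'Y_1-S'X_1$, where $X_1,Y_1$ denote $X^0_1,Y^0_1$ at $(t,C,S)$ if $\nu=0$ and $X^1_1,Y_1^1$ at $(t,C,S,0)$ if $\nu=1$. **Averages.** For $\eta(t,\varphi)$, $T$-periodic in $t$ and $\omega$-periodic in $\varphi$: $\overline\eta=\frac1{\omega T}\int_0^\omega\int_0^T\eta\,dt\,d\varphi$; $\hat\eta=0$ if $\nu=0$, $\hat\eta(\varphi)=\frac1T\int_0^T\eta\,dt-\overline\eta$ if $\nu=1$; $\tilde\eta=\eta-\overline\eta-\hat\eta$. All solutions of the averaging equations below are the doubly periodic ones with zero average (those marked with a hat depend on $\varphi$ only; for $\nu=1$ those marked with a tilde have zero average in $t$). **Admissible solutions.** The generating equation is $\overline{R^\circ}(b_{kl})=0$. For $\nu=0$ let $\tilde g$ solve $\dot{\tilde g}+\tilde g'=R^\circ-\overline{R^\circ}$. Set $K_{kl}^0=\overline{R_r^\circ-\tilde g'q}$, $K^1_{kl}=\overline{R_r^\circ-\widehat{R^\circ}q}$. A solution $b_{kl}^\star$ of the generating equation is admissible if it is in (range), if $K^\nu_{kl}\ne0$ for $b_{kl}=b_{kl}^\star$, and, when $\nu=0$, if Siegel's condition holds: for some $\vartheta>0,\tau\ge1$, $|m\omega_{kl}+nT|>\vartheta(|m|+|n|)^{-\tau}$ for all $m,n\in\mathbb Z$, $m^2+n^2\ne0$. **Averaging functions** (for fixed $b_{kl}^\star$,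 $\omega=\omega_{kl}$, $K=K^\nu_{kl}$). $\nu=0$: $\overline g=\big(\overline{\tilde g'\Phi^\circ}-\overline{R^\circ_\varepsilon}-\overline{\tilde g(R_r^\circ-\tilde g'q)}\big)/K$; $\dot{\tilde h}+\tilde h'=R_r^\circ-\tilde g'q-K$; $\dot{\tilde f}+\tilde f'=R_r^\circ(\overline g+\tilde g)+R_\varepsilon^\circ-\tilde g'(\Phi^\circ+(\overline g+\tilde g)q)$; $\Theta=\Phi^\circ+(\overline g+\tilde g)q$; $\dot{\tilde\delta}+\tilde\delta'=\Theta-\overline\Theta$; $G=\overline g+\tilde g$, $H=\tilde h$, $F=\tilde f$, $\Delta=\tilde\delta$. $\nu=1$: $\hat g'=\widehat{R^\circ}$, $\dot{\tilde g}=\widetilde{R^\circ}$; $\overline g=\big(\overline{\widehat{R^\circ}\Phi^\circ}-\overline{R_\varepsilon^\circ}-\overline{\hat g(R_r^\circ-\widehat{R^\circ}q)}\big)/K$; $\hat h'=\frac1T\int_0^TR_r^\circ dt-\widehat{R^\circ}q-K$, $\dot{\tilde h}=\widetilde{R_r^\circ}$; $\hat f'=\hat{\mathfrak F}$, $\dot{\tilde f}=\tilde{\mathfrak F}$ with $\mathfrak F=(\overline g+\hat g)(R_r^\circ-\widehat{R^\circ}q)-\widehat{R^\circ}\Phi^\circ+R_\varepsilon^\circ-\tilde g'$; $\Theta=\Phi^\circ+(\overline g+\hat g)q$; $\hat\delta'=\hat\Theta$, $\dot{\tilde\delta}=\tilde\Theta$; $G=\overline g+\hat g+\tilde g\varepsilon$,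 $H=\hat h+\tilde h\varepsilon$, $F=\hat f+\tilde f\varepsilon$, $\Delta=\hat\delta+\tilde\delta\varepsilon$. **Coordinates $(z,\psi)$.** $x=C(\varphi)+(C(\varphi)-k)\rho$, $y=S(\varphi)+(S(\varphi)-l)\rho$; $\rho=\alpha^{-1}(\varphi)(r+\beta(\varphi)r^2)$; $r=u+G(t,\varphi,\varepsilon)\varepsilon+H(t,\varphi,\varepsilon)u\varepsilon+F(t,\varphi,\varepsilon)\varepsilon^2$; $\varphi=\psi+\Delta(t,\psi,\varepsilon)\varepsilon$, with inverse written $\psi=\varphi+\Omega(t,\varphi,\varepsilon)\varepsilon$; $u=z\varepsilon^2$. **The invariant surface.** The special polar system is system (S) in the coordinates $(\rho,\varphi)$. For all sufficiently small $\varepsilon>0$, system (S) in the coordinates $(z,\psi)$ has an invariant surface $z=A^\nu_\varepsilon(t,\psi)$ with $A^\nu_\varepsilon$ continuous, $T$-periodic in $t$, $\omega$-periodic in $\psi$, bounded and Lipschitz in $\psi$ with constants independent of $\varepsilon$; correspondingly the special polar system has the invariant surface $\rho=\Upsilon^\nu_\varepsilon(t,\varphi)$, $\Upsilon^\nu_\varepsilon=\alpha^{-1}(Z+\beta Z^2)$, $Z=G\varepsilon+\big(A^\nu_\varepsilon(t,\varphi+\Omega\varepsilon)(1+H\varepsilon)+F\big)\varepsilon^2$.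
   Formalization: For ν=1 the ε² coefficient is corrected to A¹_ε+β(ḡ+ĝ)²+g̃+f̂: the printed formula omits g̃(t,φ), which comes from G=ḡ+ĝ+g̃ε, and fails whenever g̃≠0; the two agree when g̃=0. *)

(* Defs.v *)
From Stdlib Require Import Reals ZArith Lra.
From Coquelicot Require Import Coquelicot.
Open Scope R_scope.

Record cycle := Cycle {
  cy_k : Z;
  cy_l : Z;
  cy_b : R;
  cy_C : R -> R;
  cy_S : R -> R;
  cy_om : R
}.

Record is_cycle (gam : R) (c : cycle) : Prop := {
  cycle_k : (cy_k c = -1 \/ cy_k c = 0 \/ cy_k c = 1)%Z;
  cycle_l : (cy_l c = -1 \/ cy_l c = 0 \/ cy_l c = 1)%Z;
  cycle_kl : ~ (cy_k c = 0 /\ (cy_l c = -1 \/ cy_l c = 1))%Z;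
  cycle_C : forall s, is_derive (cy_C c) s (gam * (cy_S c s ^ 3 - cy_S c s));
  cycle_S : forall s, is_derive (cy_S c) s (- (cy_C c s ^ 3 - cy_C c s));
  cycle_C0 : cy_C c 0 = cy_b c;
  cycle_S0 : cy_S c 0 = IZR (cy_l c);
  cycle_om : 0 < cy_om c;
  cycle_periodic : forall s,
    cy_C c (s + cy_om c) = cy_C c s /\ cy_S c (s + cy_om c) = cy_S c s;
  cycle_minimal : forall w, 0 < w < cy_om c ->
    ~ (forall s, cy_C c (s + w) = cy_C c s /\ cy_S c (s + w) = cy_S c s)
}.

Definition r_i (gam : R) := sqrt (1 - sqrt (1 - gam)).
Definition r_e (gam : R) := sqrt (1 + sqrt (1 - gam)).
Definition r_s (gam : R) := sqrt (1 + sqrt gam).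
Definition r_sigma (gam sigma : R) :=
  sqrt (1 + sqrt (gam * sigma ^ 2 * (sigma ^ 2 - 2))).
Definition b_d (gam : R) := 1.15 - 0.16 * sqrt (0.8 - gam).
Definition b_u (gam : R) := 1.15 + 0.28 * sqrt (0.8 - gam).

Definition in_range (gam sigma : R) (c : cycle) : Prop :=
  (cy_k c = 0%Z /\ cy_l c = 0%Z /\
     (0 < cy_b c < r_i gam \/ r_e gam < cy_b c < r_sigma gam sigma))
  \/ (cy_k c <> 0%Z /\ cy_l c = 0%Z /\ 0 < gam <= 0.8 /\
     b_d gam < IZR (cy_k c) * cy_b c < b_u gam)
  \/ (cy_k c <> 0%Z /\ cy_l c <> 0%Z /\
     1 < IZR (cy_k c) * cy_b c < r_s gam).

(* Sums over all [i, j] are grouped by total degree [n = i + j]; absolute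
   convergence makes the grouping immaterial. *)
Definition real_analytic (T sigma : R) (f : R -> R -> R -> R) : Prop :=
  continuous_on
    (fun p : R * R * R => Rabs (snd (fst p)) < sigma /\ Rabs (snd p) < sigma)
    (fun p : R * R * R => f (fst (fst p)) (snd (fst p)) (snd p))
  /\ (forall t x y, Rabs x < sigma -> Rabs y < sigma -> f (t + T) x y = f t x y)
  /\ exists a : nat -> nat -> R -> R,
      (forall i j t, continuous (a i j) t /\ a i j (t + T) = a i j t)
      /\ forall t x y, Rabs x < sigma -> Rabs y < sigma ->
          ex_series (fun n => sum_n (fun i =>
            Rabs (a i (n - i)%nat t * x ^ i * y ^ (n - i))) n)
          /\ is_series (fun n => sum_n (fun i =>
            a i (n - i)%nat t * x ^ i * y ^ (n - i)) n) (f t x y).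

Definition box (sigma eps0 : R) (x y eps : R) : Prop :=
  Rabs x <= sigma /\ Rabs y <= sigma /\ 0 <= eps <= eps0.

Definition continuous_on_box (sigma eps0 : R) (f : R -> R -> R -> R -> R) : Prop :=
  continuous_on
    (fun p : R * R * R * R =>
       box sigma eps0 (snd (fst (fst p))) (snd (fst p)) (snd p))
    (fun p : R * R * R * R =>
       f (fst (fst (fst p))) (snd (fst (fst p))) (snd (fst p)) (snd p)).

(* Derivative relative to [D]: one-sided at the end points of an interval. *)
Definition is_derive_within (D : R -> Prop) (f : R -> R) (x l : R) : Prop :=
  filterlim (fun y => (f y - f x) / (y - x)) (within D (locally' x)) (locally l).

(* Class C^{0,1,1,nu} in (t, x, y, eps), nu = 0 or 1, with period T in t. *)
Definition remainder_class (nu : nat) (T sigma eps0 : R)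
    (f : R -> R -> R -> R -> R) : Prop :=
  continuous_on_box sigma eps0 f
  /\ (forall t x y eps, box sigma eps0 x y eps -> f (t + T) x y eps = f t x y eps)
  /\ (exists fx, continuous_on_box sigma eps0 fx /\
        forall t x y eps, box sigma eps0 x y eps ->
          is_derive_within (fun s => Rabs s <= sigma)
            (fun s => f t s y eps) x (fx t x y eps))
  /\ (exists fy, continuous_on_box sigma eps0 fy /\
        forall t x y eps, box sigma eps0 x y eps ->
          is_derive_within (fun s => Rabs s <= sigma)
            (fun s => f t x s eps) y (fy t x y eps))
  /\ (nu = 1%nat ->
      exists fe, continuous_on_box sigma eps0 fe /\
        forall t x y eps, box sigma eps0 x y eps ->
          is_derive_within (fun s => 0 <= s <= eps0)
            (fun s => f t x y s) eps (fe t x y eps)).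

Definition field0 (f0 f1 : R -> R -> R -> R) (f2 : R -> R -> R -> R -> R)
    (t x y eps : R) : R :=
  f0 t x y + f1 t x y * eps + f2 t x y eps * eps ^ 2.

Definition field1 (f0 : R -> R -> R -> R) (f1 : R -> R -> R -> R -> R)
    (t x y eps : R) : R :=
  f0 t x y + f1 t x y eps * eps.

Definition mean (T om : R) (eta : R -> R -> R) : R :=
  / (om * T) * RInt (fun s => RInt (fun t => eta t s) 0 T) 0 om.

Definition t_mean (T : R) (eta : R -> R -> R) (s : R) : R :=
  / T * RInt (fun t => eta t s) 0 T.

(* The hat and tilde parts for nu = 1; for nu = 0 the hat part is 0 and the
   tilde part is [eta - mean eta]. *)
Definition hat1 (T om : R) (eta : R -> R -> R) (s : R) : R :=
  t_mean T eta s - mean T om eta.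

Definition tilde1 (T om : R) (eta : R -> R -> R) (t s : R) : R :=
  eta t s - mean T om eta - hat1 T om eta s.

Definition D_t (eta : R -> R -> R) (t s : R) : R := Derive (fun t' => eta t' s) t.
Definition D_phi (eta : R -> R -> R) (t s : R) : R := Derive (fun s' => eta t s') s.

Definition doubly_periodic_C1 (T om : R) (eta : R -> R -> R) : Prop :=
  (forall t s, eta (t + T) s = eta t s /\ eta t (s + om) = eta t s)
  /\ forall t s,
      ex_derive (fun t' => eta t' s) t /\ ex_derive (fun s' => eta t s') s
      /\ continuity_2d_pt eta t s
      /\ continuity_2d_pt (D_t eta) t s /\ continuity_2d_pt (D_phi eta) t s.

Definition solves_tilde0 (T om : R) (rhs eta : R -> R -> R) : Prop :=
  doubly_periodic_C1 T om eta /\ mean T om eta = 0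
  /\ forall t s, D_t eta t s + D_phi eta t s = rhs t s.

Definition solves_tilde1 (T om : R) (rhs eta : R -> R -> R) : Prop :=
  doubly_periodic_C1 T om eta /\ (forall s, t_mean T eta s = 0)
  /\ forall t s, D_t eta t s = rhs t s.

Definition solves_hat1 (om : R) (rhs eta : R -> R) : Prop :=
  (forall s, eta (s + om) = eta s) /\ RInt eta 0 om = 0
  /\ forall s, is_derive eta s (rhs s).

Definition siegel (T om : R) : Prop :=
  exists theta tau : R, 0 < theta /\ 1 <= tau /\
    forall m n : Z, (m * m + n * n <> 0)%Z ->
      Rabs (IZR m * om + IZR n * T)
        > theta * Rpower (IZR (Z.abs m + Z.abs n)) (- tau).

Section OnCycle.

Variables (gam T : R) (c : cycle).

Let k : R := IZR (cy_k c).
Let l : R := IZR (cy_l c).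
Let C : R -> R := cy_C c.
Let S : R -> R := cy_S c.
Let om : R := cy_om c.

Definition alpha (s : R) : R :=
  Derive C s * (S s - l) - (C s - k) * Derive S s.

Definition q (s : R) : R :=
  / alpha s ^ 2 * ((C s - k) ^ 3 * (2 * C s + k)
                   + gam * (S s - l) ^ 3 * (2 * S s + l)).

Definition p (s : R) : R :=
  3 * gam * / alpha s * C s * S s
    * ((S s ^ 2 - 1) * (C s - k) ^ 2 - (C s ^ 2 - 1) * (S s - l) ^ 2).

Definition beta (s : R) : R :=
  RInt (fun v => / alpha v * (Derive alpha v * q v - p v)) 0 s.

(* [X1], [Y1] stand for the first-order coefficients as functions of (t, x, y):
   X^0_1, Y^0_1 if nu = 0, and X^1_1, Y^1_1 at eps = 0 if nu = 1. *)
Variables (X0 Y0 X1 Y1 : R -> R -> R -> R).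

Definition Rc (t s : R) : R :=
  Derive C s * Y0 t (C s) (S s) - Derive S s * X0 t (C s) (S s).

Definition Phic (t s : R) : R :=
  / alpha s * ((S s - l) * X0 t (C s) (S s) - (C s - k) * Y0 t (C s) (S s)).

Definition Prc (t s : R) : R :=
  / alpha s *
    (Derive C s * ((C s - k) * Derive (fun x => Y0 t x (S s)) (C s)
                   + (S s - l) * Derive (fun y => Y0 t (C s) y) (S s))
     - Derive S s * ((C s - k) * Derive (fun x => X0 t x (S s)) (C s)
                     + (S s - l) * Derive (fun y => X0 t (C s) y) (S s))).

Definition Rrc (t s : R) : R :=
  Prc t s + / alpha s * Derive alpha s * Phic t s - 2 * beta s * Rc t s.

Definition Rec (t s : R) : R :=
  Derive C s * Y1 t (C s) (S s) - Derive S s * X1 t (C s) (S s).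

Definition generating : Prop := mean T om Rc = 0.

Section Nu0.

Variable gt : R -> R -> R.

Definition K0 : R := mean T om (fun t s => Rrc t s - D_phi gt t s * q s).

Definition gbar0 : R :=
  (mean T om (fun t s => D_phi gt t s * Phic t s)
   - mean T om Rec
   - mean T om (fun t s => gt t s * (Rrc t s - D_phi gt t s * q s))) / K0.

Definition G0 (t s eps : R) : R := gbar0 + gt t s.

Definition Theta0 (t s : R) : R := Phic t s + (gbar0 + gt t s) * q s.

Record averaging0 (ht ft dt : R -> R -> R) : Prop := {
  avg0_g : solves_tilde0 T om (fun t s => Rc t s - mean T om Rc) gt;
  avg0_h : solves_tilde0 T om (fun t s => Rrc t s - D_phi gt t s * q s - K0) ht;
  avg0_f : solves_tilde0 T om
    (fun t s => Rrc t s * (gbar0 + gt t s) + Rec t s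
                - D_phi gt t s * (Phic t s + (gbar0 + gt t s) * q s)) ft;
  avg0_d : solves_tilde0 T om (fun t s => Theta0 t s - mean T om Theta0) dt
}.

Definition admissible0 (sigma : R) : Prop :=
  generating /\ in_range gam sigma c /\ K0 <> 0 /\ siegel T om.

End Nu0.

Definition Rhat (s : R) : R := hat1 T om Rc s.

Definition K1 : R := mean T om (fun t s => Rrc t s - Rhat s * q s).

Definition admissible1 (sigma : R) : Prop :=
  generating /\ in_range gam sigma c /\ K1 <> 0.

Section Nu1.

Variables (gh : R -> R) (gt : R -> R -> R).

Definition gbar1 : R :=
  (mean T om (fun t s => Rhat s * Phic t s)
   - mean T om Rec
   - mean T om (fun t s => gh s * (Rrc t s - Rhat s * q s))) / K1.

Definition G1 (t s eps : R) : R := gbar1 + gh s + gt t s * eps.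

Definition Ffrak (t s : R) : R :=
  (gbar1 + gh s) * (Rrc t s - Rhat s * q s) - Rhat s * Phic t s
  + Rec t s - D_phi gt t s.

Definition Theta1 (t s : R) : R := Phic t s + (gbar1 + gh s) * q s.

Record averaging1 (hh fh dh : R -> R) (ht ft dt : R -> R -> R) : Prop := {
  avg1_gh : solves_hat1 om Rhat gh;
  avg1_gt : solves_tilde1 T om (tilde1 T om Rc) gt;
  avg1_hh : solves_hat1 om (fun s => t_mean T Rrc s - Rhat s * q s - K1) hh;
  avg1_ht : solves_tilde1 T om (tilde1 T om Rrc) ht;
  avg1_fh : solves_hat1 om (hat1 T om Ffrak) fh;
  avg1_ft : solves_tilde1 T om (tilde1 T om Ffrak) ft;
  avg1_dh : solves_hat1 om (hat1 T om Theta1) dh;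
  avg1_dt : solves_tilde1 T om (tilde1 T om Theta1) dt
}.

End Nu1.

End OnCycle.

(* The shape of H, F, Delta (functions of (t, phi, eps)). *)
Definition comb0 (ft : R -> R -> R) (t s eps : R) : R := ft t s.
Definition comb1 (fh : R -> R) (ft : R -> R -> R) (t s eps : R) : R :=
  fh s + ft t s * eps.

(* Solutions stay in the domain |x|, |y| < sigma of the right-hand sides. *)
Definition solves_S (nu : nat) (gam sigma : R) (X Y : R -> R -> R -> R -> R)
    (eps : R) (x y : R -> R) : Prop :=
  forall t,
    Rabs (x t) < sigma /\ Rabs (y t) < sigma
    /\ is_derive x t
         ((gam * (y t ^ 3 - y t) + eps * X t (x t) (y t) eps) * eps ^ nu)
    /\ is_derive y t
         ((- (x t ^ 3 - x t) + eps * Y t (x t) (y t) eps) * eps ^ nu).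

(* The special polar system is (S) in the coordinates (rho, phi). *)
Definition solves_polar (nu : nat) (gam sigma : R) (c : cycle)
    (X Y : R -> R -> R -> R -> R) (eps : R) (rho phi : R -> R) : Prop :=
  (forall t, ex_derive rho t /\ ex_derive phi t)
  /\ solves_S nu gam sigma X Y eps
       (fun t => cy_C c (phi t) + (cy_C c (phi t) - IZR (cy_k c)) * rho t)
       (fun t => cy_S c (phi t) + (cy_S c (phi t) - IZR (cy_l c)) * rho t).

Definition rho_of (gam : R) (c : cycle) (r s : R) : R :=
  / alpha c s * (r + beta gam c s * r ^ 2).

Definition solves_zpsi (nu : nat) (gam sigma : R) (c : cycle)
    (X Y : R -> R -> R -> R -> R) (G H F De : R -> R -> R -> R)
    (eps : R) (z psi : R -> R) : Prop :=
  (forall t, ex_derive z t /\ ex_derive psi t)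
  /\ let phi := fun t => psi t + De t (psi t) eps * eps in
     let u := fun t => z t * eps ^ 2 in
     let r := fun t => u t + G t (phi t) eps * eps
                       + H t (phi t) eps * u t * eps
                       + F t (phi t) eps * eps ^ 2 in
     solves_polar nu gam sigma c X Y eps (fun t => rho_of gam c (r t) (phi t)) phi.

(* [A eps t psi], for 0 < eps <= es: the surface z = A eps t psi is filled by
   solutions, one through each of its points. *)
Record invariant_surface (nu : nat) (gam sigma T : R) (c : cycle)
    (X Y : R -> R -> R -> R -> R) (G H F De : R -> R -> R -> R)
    (es : R) (A : R -> R -> R -> R) : Prop := {
  inv_continuous : forall eps, 0 < eps <= es ->
    forall t s, continuity_2d_pt (A eps) t s;
  inv_periodic : forall eps, 0 < eps <= es -> forall t s,
    A eps (t + T) s = A eps t s /\ A eps t (s + cy_om c) = A eps t s;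
  inv_bounded : exists M, forall eps, 0 < eps <= es -> forall t s,
    Rabs (A eps t s) <= M;
  inv_lipschitz : exists L, forall eps, 0 < eps <= es -> forall t s1 s2,
    Rabs (A eps t s1 - A eps t s2) <= L * Rabs (s1 - s2);
  inv_invariant : forall eps, 0 < eps <= es -> forall t0 psi0,
    exists psi : R -> R, psi t0 = psi0
      /\ solves_zpsi nu gam sigma c X Y G H F De eps (fun t => A eps t (psi t)) psi
}.

Definition inverse_shift (es : R) (De Om : R -> R -> R -> R) : Prop :=
  forall eps, 0 < eps <= es -> forall t phi psi,
    phi = psi + De t psi eps * eps <-> psi = phi + Om t phi eps * eps.

Definition Upsilon (gam : R) (c : cycle) (G H F Om : R -> R -> R -> R)
    (A : R -> R -> R -> R) (eps t s : R) : R :=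
  rho_of gam c
    (G t s eps * eps
     + (A eps t (s + Om t s eps * eps) * (1 + H t s eps * eps) + F t s eps) * eps ^ 2)
    s.

(* [f eps t phi] is O(eps^n) as eps -> 0 through (0, es], uniformly in (t, phi). *)
Definition bigO (es : R) (n : nat) (f : R -> R -> R -> R) : Prop :=
  exists M, forall eps, 0 < eps <= es -> forall t s, Rabs (f eps t s) <= M * eps ^ n.

Definition expansion0 (gam : R) (c : cycle) (gb : R) (gt ft : R -> R -> R)
    (A : R -> R -> R -> R) (eps t s : R) : R :=
  / alpha c s *
    ((gb + gt t s) * eps
     + (A eps t s + beta gam c s * (gb + gt t s) ^ 2 + ft t s) * eps ^ 2).

(* The term [gt] of order eps^2 is the contribution of
   G eps = (gb + gh + gt eps) eps. *)
Definition expansion1 (gam : R) (c : cycle) (gb : R) (gh : R -> R)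
    (gt : R -> R -> R) (fh : R -> R) (A : R -> R -> R -> R) (eps t s : R) : R :=
  / alpha c s *
    ((gb + gh s) * eps
     + (A eps t s + beta gam c s * (gb + gh s) ^ 2 + gt t s + fh s) * eps ^ 2).

(* Main.v *)
Require Import Defs.
From Stdlib Require Import Reals ZArith Lra Lia Psatz.
From Stdlib Require Import ClassicalEpsilon FunctionalExtensionality.
From Coquelicot Require Import Coquelicot.
Open Scope R_scope.

(* Upsilon is an explicit expression in A and in the averaging functions, so the expansion
   is a Taylor expansion, uniform once all ingredients are bounded; the shift Omega eps in
   the argument of A costs O(eps) by the Lipschitz bound, since Omega = -Delta at the
   shifted point. What needs an argument is that 1/alpha and beta are bounded on the cycle.

   Put H = ((x^2-1)^2 + gam (y^2-1)^2) / 4, the conserved energy. alpha <> 0 is read off the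
   energy level. Around the origin alpha = 4 H + (C^2-1) + gam (S^2-1) with 4 H > 1; around
   (k, l) with k, l = 1 or -1 it is a sum of two nonnegative terms. Around (k, 0) it reduces
   to a polynomial inequality that holds with a small margin, because b_d and b_u nearly
   follow the boundary of the set where alpha has no zero.

   Along the rays of the special polar coordinates, H = H_0 + alpha rho + hess rho^2 + ...,
   and beta' = -(hess / alpha^2)', which makes beta periodic. *)

(** * The inequality behind [alpha <> 0] for cycles around (k, 0), k = 1 or -1 *)

(* With v = k C, w = S^2, b = k b_k0 and gam = 0.8 - d^2, conservation of energy gives,
   for every real c,
     (1 + c) alpha = hump c v - load c d b + gam (w - (1 - c) / 2)^2. *)
Definition hump (c v : R) : R := (1 - v) ^ 2 * (1 + v) * (v - c).

(** Reduces a lower bound on a whole interval of [v] to its two end points, where [lra] can check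
    it. *)
Lemma hump_min (c v1 v2 v : R) :
  -1 < c <= 1 -> 0 <= v1 -> v2 <= 1 -> v1 <= v <= v2 ->
  Rmin (hump c v1) (hump c v2) <= hump c v.
Proof.
intros hc h1 h2 hv.
(* [(1 - x) * h x] is the derivative; h is concave with [h 0 > 0], so hump increases, then decreases. *)
set (h := fun v => 1 + c + (3 * c - 1) * v - 4 * v ^ 2).
assert (hd : forall x, is_derive (hump c) x ((1 - x) * h x)).
{ intros x. unfold hump, h. auto_derive; [easy | ring]. }
destruct (Rle_dec 0 (h v)) as [hp | hn].
- apply Rle_trans with (1 := Rmin_l _ _).
  destruct (MVT_gen (hump c) v1 v (fun x => (1 - x) * h x)) as [x [hx e]].
  + intros x _; apply hd.
  + intros x _; apply continuity_pt_filterlim, (ex_derive_continuous (hump c) x).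
    now exists ((1 - x) * h x).
  + rewrite Rmin_left, Rmax_right in hx by lra.
    (* The chord inequality of the concave [h] on [0, v], with [h 0 = 1 + c], as an exact
       identity. *)
    assert (ex : v * h x = x * h v + (v - x) * (1 + c) + 4 * (x * v * (v - x))) by (unfold h; ring).
    assert (0 <= x * v * (v - x)) by (repeat apply Rmult_le_pos; lra).
    assert (0 <= h x).
    { destruct (Rle_dec v 0); [replace x with v by lra; easy | nra]. }
    assert (0 <= (1 - x) * h x * (v - v1)).
    { repeat apply Rmult_le_pos; lra. }
    lra.
- apply Rle_trans with (1 := Rmin_r _ _).
  destruct (MVT_gen (hump c) v v2 (fun x => (1 - x) * h x)) as [x [hx e]].
  + intros x _; apply hd.
  + intros x _; apply continuity_pt_filterlim, (ex_derive_continuous (hump c) x).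
    now exists ((1 - x) * h x).
  + rewrite Rmin_left, Rmax_right in hx by lra.
    (* The same identity read beyond [v]: a negative value of [h] at [v] persists to the right. *)
    assert (ex : v * h x = x * h v - (x - v) * (1 + c) - 4 * (x * v * (x - v))) by (unfold h; ring).
    assert (0 <= x * v * (x - v)) by (repeat apply Rmult_le_pos; lra).
    assert (v <> 0) by (intros v0; apply hn; unfold h; rewrite v0; lra).
    assert (h x <= 0) by nra.
    assert (0 <= (1 - x) * (- h x) * (v2 - v)).
    { repeat apply Rmult_le_pos; lra. }
    lra.
Qed.

Definition load (c d b : R) : R := (0.8 - d ^ 2) * (1 - c) ^ 2 / 4 - (b ^ 2 - 1) ^ 2 * c.

(** As a function of [d], the tangent line at [d0] of [load c d b] along the lower boundary
    [b = 1.15 - 0.16 * d]. *)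
Definition tangent (c d0 d : R) : R :=
  (0.8 - 2 * d0 * d + d0 ^ 2) * (1 - c) ^ 2 / 4
  - (((1.15 - 0.16 * d0) ^ 2 - 1) ^ 2
     - 0.64 * (1.15 - 0.16 * d0) * ((1.15 - 0.16 * d0) ^ 2 - 1) * (d - d0)) * c.

(** For [c >= 0] the load decreases in [b >= 1], so the lower boundary is the worst case; along it
    the load is concave in [d], because [- d ^ 2] is concave and [(b ^ 2 - 1) ^ 2] is convex for
    [b >= 1]. *)
Lemma load_le_tangent (c d0 d b : R) :
  0 <= c -> 0 <= d0 <= 0.9 -> 0 <= d <= 0.9 -> 1.15 - 0.16 * d <= b ->
  load c d b <= tangent c d0 d.
Proof.
intros hc h0 hd hb.
unfold load, tangent; remember (1.15 - 0.16 * d0) as b0 eqn:eb.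
assert (hb0 : 1 <= b0) by lra.
assert (e : (b ^ 2 - 1) ^ 2 = (b0 ^ 2 - 1) ^ 2 + 4 * b0 * (b0 ^ 2 - 1) * (b - b0)
   + (b - b0) ^ 2 * (b ^ 2 + 2 * b * b0 + 3 * b0 ^ 2 - 2)) by ring.
assert (0 <= (b - b0) ^ 2 * (b ^ 2 + 2 * b * b0 + 3 * b0 ^ 2 - 2)).
{ apply Rmult_le_pos; [apply pow2_ge_0 | nra]. }
assert (0 <= b0 * (b0 ^ 2 - 1)) by (apply Rmult_le_pos; nra).
assert (b0 * (b0 ^ 2 - 1) * (- 0.16 * (d - d0)) <= b0 * (b0 ^ 2 - 1) * (b - b0)).
{ apply Rmult_le_compat_l; [easy | lra]. }
assert ((b0 ^ 2 - 1) ^ 2 - 0.64 * b0 * (b0 ^ 2 - 1) * (d - d0) <= (b ^ 2 - 1) ^ 2) by lra.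
assert (- d ^ 2 <= - 2 * d0 * d + d0 ^ 2) by (pose proof (pow2_ge_0 (d - d0)); lra).
pose proof (pow2_ge_0 (1 - c)).
apply Rplus_le_compat; [|apply Ropp_le_contravar]; nra.
Qed.

Lemma load_le_upper (c d b : R) :
  c <= 0 -> 0 <= d -> 1 <= b <= 1.15 + 0.28 * d ->
  load c d b <= load c d (1.15 + 0.28 * d).
Proof.
intros hc hd hb.
assert (b ^ 2 <= (1.15 + 0.28 * d) ^ 2) by (apply pow_incr; lra).
assert ((b ^ 2 - 1) ^ 2 <= ((1.15 + 0.28 * d) ^ 2 - 1) ^ 2) by (apply pow_incr; nra).
unfold load; nra.
Qed.

(* For fixed v, the pairs (gam, (b^2-1)^2) at which alpha <= 0 for some w fill a convex
   set bounded by a branch of a hyperbola, and each c gives one of its tangents. A single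
   tangent separates it from all admissible pairs, and the same tangent serves a whole
   interval of v. In each line below d0 is, up to rounding, the d in [0, 0.9] at which
   load c is largest, with b = b_d for c >= 0 and b = b_u for c < 0. *)
Lemma load_lt_hump (d b v : R) :
  0 <= d <= 0.9 -> 1.15 - 0.16 * d <= b <= 1.15 + 0.28 * d -> 0 <= v <= 1 ->
  exists c, -1 < c <= 1 /\ load c d b < hump c v.
Proof.
intros hd hb hv.
assert (cover : forall c v1 v2, -1 < c <= 1 -> 0 <= v1 -> v2 <= 1 -> v1 <= v <= v2 ->
  load c d b < hump c v1 -> load c d b < hump c v2 ->
  exists c, -1 < c <= 1 /\ load c d b < hump c v).
{ intros c v1 v2 hc h1 h2 h12 l1 l2. exists c; split; [easy|].
  apply Rlt_le_trans with (2 := hump_min c v1 v2 v hc h1 h2 h12).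
  now apply Rmin_glb_lt. }
(* For [c >= 0] the tangent makes both end point checks linear in [d]. *)
assert (lower : forall c d0 v1 v2, 0 <= d0 <= 0.9 -> 0 <= c <= 1 -> 0 <= v1 -> v2 <= 1 -> v1 <= v <= v2 ->
  tangent c d0 d < hump c v1 -> tangent c d0 d < hump c v2 ->
  exists c, -1 < c <= 1 /\ load c d b < hump c v).
{ intros c d0 v1 v2 h0 hc h1 h2 h12 l1 l2.
  assert (load c d b <= tangent c d0 d) by (apply load_le_tangent; lra).
  apply (cover c v1 v2); lra. }
(* For [c <= 0] the worst case is the upper boundary, where the load is a quartic in [d]. The three
   products vanish to second order at its maximiser [d0]; [lra], treating monomials as unknowns,
   combines them into a certificate. *)
assert (upper : forall c d0 v1 v2, -1 < c <= 0 -> 0 <= v1 -> v2 <= 1 -> v1 <= v <= v2 ->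
  (0 <= (d - d0) ^ 2 * (0.9 - d) -> 0 <= (d - d0) ^ 2 * d -> 0 <= (d - d0) ^ 2 * (d * (0.9 - d)) ->
  load c d (1.15 + 0.28 * d) < hump c v1 /\ load c d (1.15 + 0.28 * d) < hump c v2) ->
  exists c, -1 < c <= 1 /\ load c d b < hump c v).
{ intros c d0 v1 v2 hc h1 h2 h12 l.
  pose proof (pow2_ge_0 (d - d0)).
  assert (0 <= d * (0.9 - d)) by (apply Rmult_le_pos; lra).
  assert (load c d b <= load c d (1.15 + 0.28 * d)) by (apply load_le_upper; lra).
  destruct l; try (apply Rmult_le_pos; lra); try lra.
  apply (cover c v1 v2); lra. }
unfold hump, load, tangent in lower, upper.
destruct (Rle_dec v 0.108).
{ apply (upper (-0.81) 0.4348 0 0.108); try lra; intros; split; lra. }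
destruct (Rle_dec v 0.2).
{ apply (upper (-0.51) 0.3471 0.108 0.2); try lra; intros; split; lra. }
destruct (Rle_dec v 0.2955).
{ apply (upper (-0.29) 0.22213 0.2 0.2955); try lra; intros; split; lra. }
destruct (Rle_dec v 0.37).
{ apply (upper (-0.1) 0.08153 0.2955 0.37); try lra; intros; split; lra. }
destruct (Rle_dec v 0.41).
{ apply (lower 0 0 0.37 0.41); lra. }
destruct (Rle_dec v 0.458).
{ apply (lower 0.07 0.0366 0.41 0.458); lra. }
destruct (Rle_dec v 0.5456).
{ apply (lower 0.2 0.125 0.458 0.5456); lra. }
destruct (Rle_dec v 0.708).
{ apply (lower 0.41 0.335 0.5456 0.708); lra. }
destruct (Rle_dec v 0.898).
{ apply (lower 0.68 0.696 0.708 0.898); lra. }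
apply (lower 0.9 0.9 0.898 1); lra.
Qed.

(** With [gam = 0.8 - d ^ 2], [load (-1) d b] is [gam + (b ^ 2 - 1) ^ 2], the value of 4 H on a
    cycle around (k, 0). Points with C = 0 have 4 H >= 1, so this bound keeps k C positive. *)
Lemma load_neg1_lt (d b : R) :
  0 <= d <= 0.9 -> 1 <= b <= 1.15 + 0.28 * d -> load (-1) d b < 1.
Proof.
intros hd hb.
apply Rle_lt_trans with (1 := load_le_upper (-1) d b ltac:(lra) (proj1 hd) hb).
(* [0.448] is, up to rounding, the maximiser in [d] of the load on the upper boundary; the bound
   there is about 0.992. *)
pose proof (pow2_ge_0 (d - 0.448)) as h0.
assert (h1 : 0 <= (d - 0.448) ^ 2 * d) by (apply Rmult_le_pos; lra).
assert (h2 : 0 <= (d - 0.448) ^ 2 * (0.9 - d)) by (apply Rmult_le_pos; lra).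
assert (h3 : 0 <= (d - 0.448) ^ 2 * (d * (0.9 - d))).
{ apply Rmult_le_pos; [easy | apply Rmult_le_pos; lra]. }
unfold load; lra.
Qed.

(** * The cycle and the function alpha *)

Lemma pos_of_never_zero (f : R -> R) :
  (forall x, continuous f x) -> (forall x, f x <> 0) -> 0 < f 0 -> forall x, 0 < f x.
Proof.
intros hf hz h0 x.
destruct (Rlt_le_dec 0 (f x)) as [h | h]; [easy | exfalso].
destruct (IVT_gen f 0 x 0) as [y [_ hy]].
- intros y; apply continuity_pt_filterlim, hf.
- rewrite Rmin_right, Rmax_left; lra.
- exact (hz y hy).
Qed.

Lemma ex_derive_C (gam : R) (c : cycle) (s : R) :
  is_cycle gam c -> ex_derive (cy_C c) s.
Proof. intros hc; eexists; apply (cycle_C _ _ hc). Qed.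

Lemma ex_derive_S (gam : R) (c : cycle) (s : R) :
  is_cycle gam c -> ex_derive (cy_S c) s.
Proof. intros hc; eexists; apply (cycle_S _ _ hc). Qed.

Ltac ex_derive_cycle hc :=
  repeat split;
  lazymatch goal with
  | |- ex_derive (fun x => cy_C _ x) _ => exact (ex_derive_C _ _ _ hc)
  | |- ex_derive (fun x => cy_S _ x) _ => exact (ex_derive_S _ _ _ hc)
  | |- _ => idtac
  end.

Lemma Derive_C (gam : R) (c : cycle) (s : R) :
  is_cycle gam c -> Derive (cy_C c) s = gam * (cy_S c s ^ 3 - cy_S c s).
Proof. intros hc; apply is_derive_unique, (cycle_C _ _ hc). Qed.

Lemma Derive_S (gam : R) (c : cycle) (s : R) :
  is_cycle gam c -> Derive (cy_S c) s = - (cy_C c s ^ 3 - cy_C c s).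
Proof. intros hc; apply is_derive_unique, (cycle_S _ _ hc). Qed.

Lemma alpha_eq (gam : R) (c : cycle) (s : R) :
  is_cycle gam c ->
  alpha c s = gam * (cy_S c s ^ 3 - cy_S c s) * (cy_S c s - IZR (cy_l c))
    + (cy_C c s - IZR (cy_k c)) * (cy_C c s ^ 3 - cy_C c s).
Proof.
intros hc; unfold alpha; rewrite (Derive_C _ _ _ hc), (Derive_S _ _ _ hc); ring.
Qed.

Lemma energy (gam : R) (c : cycle) (s : R) :
  is_cycle gam c ->
  (cy_C c s ^ 2 - 1) ^ 2 + gam * (cy_S c s ^ 2 - 1) ^ 2
  = (cy_b c ^ 2 - 1) ^ 2 + gam * (IZR (cy_l c) ^ 2 - 1) ^ 2.
Proof.
intros hc.
set (E := fun s => (cy_C c s ^ 2 - 1) ^ 2 + gam * (cy_S c s ^ 2 - 1) ^ 2).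
assert (hE : forall s, is_derive E s 0).
{ intros x; unfold E; auto_derive.
  - ex_derive_cycle hc.
  - change (Derive (fun x => cy_C c x) x) with (Derive (cy_C c) x).
    change (Derive (fun x => cy_S c x) x) with (Derive (cy_S c) x).
    rewrite (Derive_C _ _ _ hc), (Derive_S _ _ _ hc); ring. }
change (E s = (cy_b c ^ 2 - 1) ^ 2 + gam * (IZR (cy_l c) ^ 2 - 1) ^ 2).
rewrite <- (cycle_C0 _ _ hc), <- (cycle_S0 _ _ hc).
change (E s = E 0).
destruct (Rtotal_order s 0) as [h | [-> | h]]; [|easy|].
- apply (eq_is_derive E s 0); [intros; apply hE | easy].
- symmetry; apply (eq_is_derive E 0 s); [intros; apply hE | easy].
Qed.

(** Both ranges of [b] give 4 H > 1. Where C^2 >= 1 or S^2 >= 1, this makes [alpha] positive.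
    Elsewhere C^2 (C^2 - 1) and gam S^2 (S^2 - 1), whose sum is [alpha], are nonpositive and vanish
    together only at the origin. *)
Lemma alpha_neq0_around_origin (gam sigma : R) (c : cycle) (s : R) :
  0 < gam <= 1 -> is_cycle gam c -> cy_k c = 0%Z -> cy_l c = 0%Z ->
  0 < cy_b c < r_i gam \/ r_e gam < cy_b c < r_sigma gam sigma ->
  alpha c s <> 0.
Proof.
intros hg hc hk hl hb.
assert (hroot : 0 <= sqrt (1 - gam) /\ sqrt (1 - gam) ^ 2 = 1 - gam).
{ split; [apply sqrt_pos | apply pow2_sqrt; lra]. }
destruct hroot as [r0 r2].
pose proof (fun s => energy gam c s hc) as hE.
rewrite hl in hE.
assert (hm : (cy_b c ^ 2 - 1) ^ 2 > 1 - gam /\ (1 < cy_b c ^ 2 \/ 0 < cy_b c ^ 2 < 1)).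
{ destruct hb as [[b0 hb] | [hb _]]; unfold r_i, r_e in hb.
  - assert (h : cy_b c ^ 2 < 1 - sqrt (1 - gam)).
    { assert (0 <= 1 - sqrt (1 - gam)) by nra.
      rewrite <- (pow2_sqrt (1 - sqrt (1 - gam))) by easy.
      pose proof (sqrt_pos (1 - sqrt (1 - gam))); nra. }
    split; [|right]; nra.
  - assert (h : 1 + sqrt (1 - gam) < cy_b c ^ 2).
    { rewrite <- (pow2_sqrt (1 + sqrt (1 - gam))) by lra.
      pose proof (sqrt_pos (1 + sqrt (1 - gam))); nra. }
    split; [|left]; nra. }
destruct hm as [hm hb2].
(* The origin is a zero of [alpha] and must be kept off the cycle. For [b <> 0] it lies on the same
   energy level only if [b ^ 2 = 2], and then continuity rules it out. *)
assert (hor : cy_C c s <> 0 \/ cy_S c s <> 0).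
{ destruct (Req_dec (cy_C c s) 0) as [C0 |]; [|now left].
  destruct (Req_dec (cy_S c s) 0) as [S0 |]; [|now right].
  exfalso.
  pose proof (hE s) as e; rewrite C0, S0 in e.
  destruct hb2 as [hb2 | hb2]; [|nra].
  (* The level set of the origin consists of the origin and of points with C^2 >= 1 or S^2 >= 1. *)
  assert (hpos := pos_of_never_zero (fun s => cy_C c s ^ 2 + cy_S c s ^ 2 - 1 / 2)).
  cbv beta in hpos.
  assert (h : 0 < cy_C c s ^ 2 + cy_S c s ^ 2 - 1 / 2).
  { apply hpos.
    - intros x; apply (ex_derive_continuous (V := R_NormedModule)); auto_derive; ex_derive_cycle hc.
    - intros x hx; pose proof (hE x) as ex.
      pose proof (pow2_ge_0 (cy_C c x)); pose proof (pow2_ge_0 (cy_S c x)).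
      set (X := cy_C c x ^ 2) in *; set (Y := cy_S c x ^ 2) in *.
      assert ((X - 1) ^ 2 + X <= 1) by nra.
      assert ((Y - 1) ^ 2 <= 1) by nra.
      assert (gam * (Y - 1) ^ 2 <= gam) by nra.
      assert (X = 0) by nra.
      assert (Y = 1 / 2) by lra.
      nra.
    - rewrite (cycle_C0 _ _ hc), (cycle_S0 _ _ hc), hl; lra. }
  rewrite C0, S0 in h; lra. }
rewrite (alpha_eq gam c s hc), hk, hl.
pose proof (hE s) as e.
pose proof (pow2_ge_0 (cy_C c s)); pose proof (pow2_ge_0 (cy_S c s)).
assert (hXY : 0 < cy_C c s ^ 2 \/ 0 < cy_S c s ^ 2).
{ destruct hor; [left | right]; now apply pow2_gt_0. }
replace (gam * (cy_S c s ^ 3 - cy_S c s) * (cy_S c s - 0)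
         + (cy_C c s - 0) * (cy_C c s ^ 3 - cy_C c s))
  with (gam * (cy_S c s ^ 2 * (cy_S c s ^ 2 - 1)) + cy_C c s ^ 2 * (cy_C c s ^ 2 - 1)) by ring.
set (X := cy_C c s ^ 2) in *; set (Y := cy_S c s ^ 2) in *.
clearbody X Y.
destruct (Rle_dec 1 X) as [hX | hX].
{ assert (0 <= gam * Y) by nra. nra. }
destruct (Rle_dec 1 Y) as [hY | hY].
{ assert (0 <= gam * (Y - 1)) by nra. nra. }
assert (0 <= gam * (Y * (1 - Y))) by (repeat apply Rmult_le_pos; lra).
assert (0 <= X * (1 - X)) by (apply Rmult_le_pos; lra).
destruct hXY.
- assert (0 < X * (1 - X)) by (apply Rmult_lt_0_compat; lra). nra.
- assert (0 < gam * (Y * (1 - Y))) by (repeat apply Rmult_lt_0_compat; lra). nra.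
Qed.

Lemma unit_sqr (c : Z) : (c = -1 \/ c = 0 \/ c = 1)%Z -> c <> 0%Z -> IZR c ^ 2 = 1.
Proof. intros [-> | [-> | ->]] h; try easy; ring. Qed.

(** A zero of [alpha] would turn the identity for [(1 + a) * alpha] into [hump a v <= load a d b].
    It remains to know that [v = k C] is positive and to choose [a] according to [v]. *)
Lemma alpha_neq0_around_pair (gam : R) (c : cycle) (s : R) :
  0 < gam <= 0.8 -> is_cycle gam c -> cy_k c <> 0%Z -> cy_l c = 0%Z ->
  b_d gam < IZR (cy_k c) * cy_b c < b_u gam ->
  alpha c s <> 0.
Proof.
intros hg hc hk hl hb.
pose proof (unit_sqr _ (cycle_k _ _ hc) hk) as k2.
unfold b_d, b_u in hb.
set (k := IZR (cy_k c)) in *.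
set (d := sqrt (0.8 - gam)) in *.
assert (hd : 0 <= d /\ d ^ 2 = 0.8 - gam).
{ split; [apply sqrt_pos | apply pow2_sqrt; lra]. }
destruct hd as [d0 d2].
assert (d1 : d <= 0.9) by nra.
assert (hm : (cy_b c ^ 2 - 1) ^ 2 = ((k * cy_b c) ^ 2 - 1) ^ 2) by (rewrite Rpow_mult_distr, k2; ring).
pose proof (fun s => energy gam c s hc) as hE.
rewrite hl, hm in hE.
set (b := k * cy_b c) in *.
pose proof (load_neg1_lt d b (conj d0 d1) ltac:(lra)) as hlt.
unfold load in hlt; rewrite d2 in hlt.
assert (hv : 0 < k * cy_C c s).
{ assert (hpos := pos_of_never_zero (fun s => k * cy_C c s)); cbv beta in hpos.
  apply hpos.
  - intros x; apply (ex_derive_continuous (V := R_NormedModule)); auto_derive; ex_derive_cycle hc.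
  - intros x hx.
    assert (C0 : cy_C c x = 0).
    { transitivity (k ^ 2 * cy_C c x); [rewrite k2; ring|].
      transitivity (k * (k * cy_C c x)); [ring | rewrite hx; ring]. }
    pose proof (hE x) as e; rewrite C0 in e.
    assert (0 <= gam * (cy_S c x ^ 2 - 1) ^ 2).
    { apply Rmult_le_pos; [lra | apply pow2_ge_0]. }
    nra.
  - rewrite (cycle_C0 _ _ hc); fold b; lra. }
rewrite (alpha_eq gam c s hc), hl; fold k.
pose proof (hE s) as e.
(* Multiplying and dividing by [k ^ 4 = 1] brings in [v = k C], which treats both signs of [k] at
   once. *)
replace (gam * (cy_S c s ^ 3 - cy_S c s) * (cy_S c s - 0)
         + (cy_C c s - k) * (cy_C c s ^ 3 - cy_C c s))
  with (gam * (cy_S c s ^ 2 * (cy_S c s ^ 2 - 1))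
        + (k * cy_C c s - k ^ 2) * (k * cy_C c s) * ((k * cy_C c s) ^ 2 - k ^ 2) / k ^ 4)
  by (field; intros hk0; rewrite hk0 in k2; lra).
assert (hX : (cy_C c s ^ 2 - 1) ^ 2 = ((k * cy_C c s) ^ 2 - 1) ^ 2) by (rewrite Rpow_mult_distr, k2; ring).
rewrite hX in e.
replace (k ^ 4) with ((k ^ 2) ^ 2) by ring; rewrite k2.
set (v := k * cy_C c s) in *; set (w := cy_S c s ^ 2) in *.
assert (hc' : exists a, -1 < a <= 1 /\ load a d b < hump a v).
{ destruct (Rle_dec v 1) as [v1 | v1].
  - apply load_lt_hump; lra.
  (* Beyond [v = 1] take [a = 1]: the load is then [- (b ^ 2 - 1) ^ 2 < 0], while the hump is
     nonnegative. *)
  - exists 1; split; [lra|]; unfold load, hump.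
    assert (0 < (b ^ 2 - 1) ^ 2) by (apply pow_lt; nra).
    assert (0 <= (1 - v) ^ 2 * (1 + v) * (v - 1)).
    { apply Rmult_le_pos; [apply Rmult_le_pos; [apply pow2_ge_0 |] |]; lra. }
    lra. }
destruct hc' as [a [ha hl']].
assert (id : (1 + a) * (gam * (w * (w - 1)) + (v - 1) * v * (v ^ 2 - 1) / 1 ^ 2)
  = hump a v - load a d b + gam * (w - (1 - a) / 2) ^ 2).
{ unfold hump, load; rewrite d2.
  replace ((b ^ 2 - 1) ^ 2) with ((v ^ 2 - 1) ^ 2 + gam * (w - 1) ^ 2 - gam) by lra.
  field. }
assert (0 <= gam * (w - (1 - a) / 2) ^ 2) by (apply Rmult_le_pos; [lra | apply pow2_ge_0]).
intros z; rewrite z in id; lra.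
Qed.

(** The level satisfies 0 < 4 H < gam. Since 4 H >= 1 on C = 0 and 4 H >= gam on S = 0, both k C and
    l S stay positive, and [alpha] is a sum of two nonnegative terms. They vanish together only at
    (k, l), where H = 0. *)
Lemma alpha_neq0_around_corner (gam : R) (c : cycle) (s : R) :
  0 < gam <= 1 -> is_cycle gam c -> cy_k c <> 0%Z -> cy_l c <> 0%Z ->
  1 < IZR (cy_k c) * cy_b c < r_s gam ->
  alpha c s <> 0.
Proof.
intros hg hc hk hl hb.
pose proof (unit_sqr _ (cycle_k _ _ hc) hk) as k2.
pose proof (unit_sqr _ (cycle_l _ _ hc) hl) as l2.
pose proof (fun s => energy gam c s hc) as hE.
rewrite (alpha_eq gam c s hc).
pose proof (cycle_C0 _ _ hc) as C0.
pose proof (cycle_S0 _ _ hc) as S0.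
assert (hC := pos_of_never_zero (fun s => IZR (cy_k c) * cy_C c s)).
assert (hS := pos_of_never_zero (fun s => IZR (cy_l c) * cy_S c s)).
cbv beta in hC, hS; rewrite C0 in hC; rewrite S0 in hS.
set (k := IZR (cy_k c)) in *; set (l := IZR (cy_l c)) in *.
assert (hbk : cy_b c ^ 2 = (k * cy_b c) ^ 2) by (rewrite Rpow_mult_distr, k2; ring).
rewrite l2 in hE.
assert (hm : 0 < (cy_b c ^ 2 - 1) ^ 2 < gam).
{ rewrite hbk; set (b := k * cy_b c) in *.
  assert (r0 : 0 <= sqrt gam) by apply sqrt_pos.
  assert (r2 : sqrt gam ^ 2 = gam) by (apply pow2_sqrt; lra).
  unfold r_s in hb.
  assert (b ^ 2 < 1 + sqrt gam).
  { rewrite <- (pow2_sqrt (1 + sqrt gam)) by lra.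
    pose proof (sqrt_pos (1 + sqrt gam)); nra. }
  assert (0 < b ^ 2 - 1) by nra.
  assert (0 < (sqrt gam - (b ^ 2 - 1)) * (sqrt gam + (b ^ 2 - 1))).
  { apply Rmult_lt_0_compat; lra. }
  split; [now apply pow_lt | lra]. }
assert (hk0 : k <> 0) by (intros e; rewrite e in k2; lra).
assert (hl0 : l <> 0) by (intros e; rewrite e in l2; lra).
assert (gpos : forall x, 0 <= gam * x ^ 2) by (intros x; apply Rmult_le_pos; [lra | apply pow2_ge_0]).
assert (hCs : 0 < k * cy_C c s).
{ apply hC; [| |lra].
  - intros x; apply (ex_derive_continuous (V := R_NormedModule)); auto_derive; ex_derive_cycle hc.
  - intros x hx; apply Rmult_integral in hx; destruct hx as [hx | hx]; [easy|].
    pose proof (hE x) as e; rewrite hx in e.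
    pose proof (gpos (cy_S c x ^ 2 - 1)); lra. }
assert (hSs : 0 < l * cy_S c s).
{ apply hS; [| |lra].
  - intros x; apply (ex_derive_continuous (V := R_NormedModule)); auto_derive; ex_derive_cycle hc.
  - intros x hx; apply Rmult_integral in hx; destruct hx as [hx | hx]; [easy|].
    pose proof (hE x) as e; rewrite hx in e.
    pose proof (pow2_ge_0 (cy_C c x ^ 2 - 1)); lra. }
pose proof (hE s) as e.
set (X := cy_C c s) in *; set (Y := cy_S c s) in *.
replace (gam * (Y ^ 3 - Y) * (Y - l) + (X - k) * (X ^ 3 - X))
  with (gam * (Y - l) ^ 2 * (Y ^ 2 + l * Y) + (X - k) ^ 2 * (X ^ 2 + k * X)).
2: { replace (Y ^ 3 - Y) with (Y ^ 3 - l ^ 2 * Y) by (rewrite l2; ring).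
     replace (X ^ 3 - X) with (X ^ 3 - k ^ 2 * X) by (rewrite k2; ring).
     ring. }
assert (0 < Y ^ 2 + l * Y) by (pose proof (pow2_ge_0 Y); lra).
assert (0 < X ^ 2 + k * X) by (pose proof (pow2_ge_0 X); lra).
assert (0 <= gam * (Y - l) ^ 2 * (Y ^ 2 + l * Y)) by (apply Rmult_le_pos; [apply gpos | lra]).
assert (0 <= (X - k) ^ 2 * (X ^ 2 + k * X)) by (apply Rmult_le_pos; [apply pow2_ge_0 | lra]).
intros z.
assert (zX : (X - k) ^ 2 * (X ^ 2 + k * X) = 0) by lra.
assert (zY : gam * (Y - l) ^ 2 * (Y ^ 2 + l * Y) = 0) by lra.
assert (X = k) by (apply Rmult_integral in zX; destruct zX; nra).
assert (Y = l).
{ apply Rmult_integral in zY; destruct zY as [zY |]; [|lra].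
  apply Rmult_integral in zY; destruct zY; nra. }
replace (X ^ 2) with (k ^ 2) in e by (subst X; congruence).
replace (Y ^ 2) with (l ^ 2) in e by (congruence).
rewrite k2, l2 in e; lra.
Qed.

Lemma alpha_neq0 (gam sigma : R) (c : cycle) (s : R) :
  0 < gam <= 1 -> is_cycle gam c -> in_range gam sigma c -> alpha c s <> 0.
Proof.
intros hg hc [[hk [hl hb]] | [[hk [hl [hg' hb]]] | [hk [hl hb]]]].
- now apply (alpha_neq0_around_origin gam sigma).
- now apply (alpha_neq0_around_pair gam).
- now apply (alpha_neq0_around_corner gam).
Qed.

(** * Boundedness and the function beta *)

(** [U] is arbitrary so that the period in t can be reduced for the whole function of s at once. *)
Lemma reduce_period {U : Type} (T : R) (f : R -> U) (t : R) :
  0 < T -> (forall t, f (t + T) = f t) -> exists t', 0 <= t' <= T /\ f t = f t'.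
Proof.
intros hT hf.
assert (hn : forall (n : nat) t, f (t + INR n * T) = f t).
{ induction n as [|n IH]; intros x; [replace (x + INR 0 * T) with x by (simpl; ring); easy|].
  rewrite S_INR; replace (x + (INR n + 1) * T) with (x + INR n * T + T) by ring.
  now rewrite hf. }
destruct (floor_ex (t / T)) as [n [h1 h2]].
exists (t - IZR n * T); split.
- assert (e : t = t / T * T) by (field; lra).
  revert e h1 h2; generalize (t / T); intros x -> h1 h2; split; nra.
- destruct (Z_le_gt_dec 0 n) as [h | h].
  + rewrite <- (hn (Z.to_nat n) (t - IZR n * T)), INR_IZR_INZ, Z2Nat.id by easy.
    f_equal; ring.
  + rewrite <- (hn (Z.to_nat (- n)) t), INR_IZR_INZ, Z2Nat.id, opp_IZR by lia.
    f_equal; ring.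
Qed.

Definition bounded_2d (f : R -> R -> R) : Prop := exists M, forall t s, Rabs (f t s) <= M.

Lemma bounded_of_periodic_2d (T om : R) (f : R -> R -> R) :
  0 < T -> 0 < om -> (forall t s, continuity_2d_pt f t s) ->
  (forall t s, f (t + T) s = f t s /\ f t (s + om) = f t s) -> bounded_2d f.
Proof.
intros hT hom hf hp.
assert (hr : forall u v, exists r : posreal, forall x y,
  Rabs (x - u) < r -> Rabs (y - v) < r -> Rabs (f x y - f u v) < 1).
{ intros u v; exact (hf u v (mkposreal 1 Rlt_0_1)). }
set (rad := fun u v => proj1_sig (constructive_indefinite_description _ (hr u v))).
assert (hpos : forall u v, 0 < Rmin (rad u v) (/ (1 + Rabs (f u v)))).
{ intros u v; apply Rmin_pos; [apply cond_pos|].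
  apply Rinv_0_lt_compat; pose proof (Rabs_pos (f u v)); lra. }
(* A radius below 1 / (1 + |f|) turns the lower bound on the radii into an upper bound on f. *)
destruct (compactness_value_2d 0 T 0 om (fun u v => mkposreal _ (hpos u v))) as [d hd].
exists (/ d + 1); intros t s.
destruct (reduce_period T f t hT) as [t' [ht ->]].
{ intros x; apply functional_extensionality; intros y; apply hp. }
destruct (reduce_period om (f t') s hom) as [s' [hs ->]].
{ intros y; apply hp. }
(* The compactness result provides its finite cover only under a double negation, hence the argument
   by contradiction. *)
apply Rnot_lt_le; intros hbig.
apply (hd t' s' ht hs); intros [u [v [_ [_ [hu [hv hdr]]]]]]; simpl in hu, hv, hdr.
assert (hlt : Rabs (f t' s' - f u v) < 1).
{ apply (proj2_sig (constructive_indefinite_description _ (hr u v)));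
    eapply Rlt_le_trans; [exact hu | apply Rmin_l | exact hv | apply Rmin_l]. }
assert (hfu : 1 + Rabs (f u v) <= / d).
{ pose proof (Rabs_pos (f u v)).
  rewrite <- (Rinv_inv (1 + Rabs (f u v))).
  apply Rinv_le_contravar; [apply cond_pos|].
  apply Rle_trans with (1 := hdr), Rmin_r. }
pose proof (Rabs_triang (f t' s' - f u v) (f u v)) as ht3.
replace (f t' s' - f u v + f u v) with (f t' s') in ht3 by ring.
lra.
Qed.

Lemma bounded_of_periodic (om : R) (f : R -> R) :
  0 < om -> (forall s, ex_derive f s) -> (forall s, f (s + om) = f s) ->
  bounded_2d (fun _ s => f s).
Proof.
intros hom hf hp.
apply (bounded_of_periodic_2d 1 om); [lra | easy | | easy].
intros t s; apply (continuity_1d_2d_pt_comp f (fun _ v => v)).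
- apply continuity_pt_filterlim, (ex_derive_continuous f s), hf.
- apply continuity_2d_pt_id2.
Qed.

(** * The derivative of [alpha] and a closed form of [beta] *)

Lemma is_derive_alpha (gam : R) (c : cycle) (s : R) :
  is_cycle gam c ->
  is_derive (alpha c) s
    (gam * (3 * cy_S c s ^ 2 - 1) * (cy_S c s - IZR (cy_l c)) * (- (cy_C c s ^ 3 - cy_C c s))
     + (cy_C c s - IZR (cy_k c)) * (3 * cy_C c s ^ 2 - 1) * (gam * (cy_S c s ^ 3 - cy_S c s))).
Proof.
intros hc.
apply (is_derive_ext (fun s => gam * (cy_S c s ^ 3 - cy_S c s) * (cy_S c s - IZR (cy_l c))
  + (cy_C c s - IZR (cy_k c)) * (cy_C c s ^ 3 - cy_C c s))).
{ intros t; symmetry; now apply alpha_eq. }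
auto_derive.
- ex_derive_cycle hc.
- change (Derive (fun x => cy_C c x) s) with (Derive (cy_C c) s).
  change (Derive (fun x => cy_S c x) s) with (Derive (cy_S c) s).
  rewrite (Derive_C _ _ _ hc), (Derive_S _ _ _ hc); ring.
Qed.

(* The coefficient of rho^2 in the energy H along the rays; that of rho is alpha. *)
Definition hess (gam : R) (c : cycle) (s : R) : R :=
  ((3 * cy_C c s ^ 2 - 1) * (cy_C c s - IZR (cy_k c)) ^ 2
   + gam * (3 * cy_S c s ^ 2 - 1) * (cy_S c s - IZR (cy_l c)) ^ 2) / 2.

Definition beta_primitive (gam : R) (c : cycle) (s : R) : R :=
  - hess gam c s / alpha c s ^ 2.

Lemma cube_unit (k : Z) : (k = -1 \/ k = 0 \/ k = 1)%Z -> IZR k ^ 3 = IZR k.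
Proof. intros [-> | [-> | ->]]; ring. Qed.

(** The numerators agree because [k ^ 3 = k] and [l ^ 3 = l]. In this form of [q] the integrand of
    [beta] can be recognised as an exact derivative. *)
Lemma q_eq (gam : R) (c : cycle) (s : R) :
  is_cycle gam c -> q gam c s = (2 * hess gam c s - alpha c s) / alpha c s ^ 2.
Proof.
intros hc.
pose proof (cube_unit _ (cycle_k _ _ hc)) as k3.
pose proof (cube_unit _ (cycle_l _ _ hc)) as l3.
unfold q, Rdiv; rewrite (Rmult_comm _ (/ alpha c s ^ 2)); f_equal.
rewrite (alpha_eq gam c s hc); unfold hess.
set (k := IZR (cy_k c)) in *; set (l := IZR (cy_l c)) in *.
set (X := cy_C c s); set (Y := cy_S c s).
assert (e1 : (X - k) ^ 3 * (2 * X + k)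
  = (3 * X ^ 2 - 1) * (X - k) ^ 2 - (X - k) * (X ^ 3 - X) + (X - k) * (k ^ 3 - k)) by ring.
assert (e2 : (Y - l) ^ 3 * (2 * Y + l)
  = (3 * Y ^ 2 - 1) * (Y - l) ^ 2 - (Y ^ 3 - Y) * (Y - l) + (Y - l) * (l ^ 3 - l)) by ring.
rewrite k3 in e1; rewrite l3 in e2.
replace (gam * (Y - l) ^ 3 * (2 * Y + l)) with (gam * ((Y - l) ^ 3 * (2 * Y + l))) by ring.
rewrite e1, e2; field.
Qed.

Lemma ex_derive_hess (gam : R) (c : cycle) (s : R) :
  is_cycle gam c -> ex_derive (hess gam c) s.
Proof.
intros hc; unfold hess; auto_derive.
ex_derive_cycle hc.
Qed.

Lemma ex_derive_beta_primitive (gam : R) (c : cycle) (s : R) :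
  is_cycle gam c -> alpha c s <> 0 -> ex_derive (beta_primitive gam c) s.
Proof.
intros hc ha; unfold beta_primitive; auto_derive.
repeat split.
- now apply ex_derive_hess.
- eexists; now apply (is_derive_alpha gam).
- nra.
Qed.

Definition beta_integrand (gam : R) (c : cycle) (v : R) : R :=
  / alpha c v * (Derive (alpha c) v * q gam c v - p gam c v).

Lemma is_derive_beta_primitive (gam : R) (c : cycle) (s : R) :
  is_cycle gam c -> alpha c s <> 0 ->
  is_derive (beta_primitive gam c) s (beta_integrand gam c s).
Proof.
intros hc ha.
(* The first two summands are [alpha * p], so [hess' = alpha * p + alpha']; this is how [p] enters
   the derivative of [- hess / alpha ^ 2]. *)
set (dh := 3 * cy_C c s * (gam * (cy_S c s ^ 3 - cy_S c s)) * (cy_C c s - IZR (cy_k c)) ^ 2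
  + gam * (3 * cy_S c s * (- (cy_C c s ^ 3 - cy_C c s))) * (cy_S c s - IZR (cy_l c)) ^ 2
  + Derive (alpha c) s).
assert (hh : is_derive (hess gam c) s dh).
{ unfold dh; rewrite (is_derive_unique _ _ _ (is_derive_alpha gam c s hc)).
  unfold hess; auto_derive.
  - ex_derive_cycle hc.
  - change (Derive (fun x => cy_C c x) s) with (Derive (cy_C c) s).
    change (Derive (fun x => cy_S c x) s) with (Derive (cy_S c) s).
    rewrite (Derive_C _ _ _ hc), (Derive_S _ _ _ hc); field. }
unfold beta_primitive; auto_derive.
- repeat split; [now exists dh | eexists; now apply (is_derive_alpha gam) | nra].
- change (Derive (fun x => hess gam c x) s) with (Derive (hess gam c) s).
  change (Derive (fun x => alpha c x) s) with (Derive (alpha c) s).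
  rewrite (is_derive_unique _ _ _ hh).
  unfold beta_integrand, p; rewrite (q_eq _ _ _ hc); unfold dh; field.
  exact ha.
Qed.

(** Makes the periodicity of [beta] visible: its antiderivative is built from functions periodic
    along the cycle. *)
Lemma beta_eq (gam : R) (c : cycle) (s : R) :
  is_cycle gam c -> (forall v, alpha c v <> 0) ->
  beta gam c s = beta_primitive gam c s - beta_primitive gam c 0.
Proof.
intros hc ha.
apply is_RInt_unique.
apply (is_RInt_derive (V := R_CompleteNormedModule) (beta_primitive gam c) (beta_integrand gam c)).
- intros v _; now apply is_derive_beta_primitive.
- intros v _.
  (* An explicit polynomial in place of [Derive (alpha c)], so that continuity of the integrand does
     not require a second derivative of [alpha]. *)
  set (da := fun s => gam * (3 * cy_S c s ^ 2 - 1) * (cy_S c s - IZR (cy_l c)) * (- (cy_C c s ^ 3 - cy_C c s))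
     + (cy_C c s - IZR (cy_k c)) * (3 * cy_C c s ^ 2 - 1) * (gam * (cy_S c s ^ 3 - cy_S c s))).
  apply (continuous_ext (fun s => / alpha c s * (da s * q gam c s - p gam c s))).
  { intros x; unfold beta_integrand.
    now rewrite (is_derive_unique _ _ _ (is_derive_alpha gam c x hc)). }
  apply (ex_derive_continuous (V := R_NormedModule)); unfold da, q, p; auto_derive.
  assert (ea : ex_derive (fun x => alpha c x) v) by (eexists; now apply (is_derive_alpha gam)).
  assert (alpha c v ^ 2 <> 0) by now apply pow_nonzero.
  ex_derive_cycle hc; easy.
Qed.

Lemma alpha_periodic (gam : R) (c : cycle) (s : R) :
  is_cycle gam c -> alpha c (s + cy_om c) = alpha c s.
Proof.
intros hc; rewrite !(alpha_eq gam) by easy.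
now destruct (cycle_periodic _ _ hc s) as [-> ->].
Qed.

Lemma bounded_inv_alpha (gam : R) (c : cycle) :
  is_cycle gam c -> (forall v, alpha c v <> 0) -> bounded_2d (fun _ s => / alpha c s).
Proof.
intros hc ha; apply (bounded_of_periodic (cy_om c)).
- apply (cycle_om _ _ hc).
- intros s; auto_derive; repeat split; [eexists; now apply (is_derive_alpha gam) | apply ha].
- intros s; now rewrite (alpha_periodic gam).
Qed.

Lemma bounded_beta (gam : R) (c : cycle) :
  is_cycle gam c -> (forall v, alpha c v <> 0) -> bounded_2d (fun _ s => beta gam c s).
Proof.
intros hc ha; apply (bounded_of_periodic (cy_om c)).
- apply (cycle_om _ _ hc).
- intros s; apply (ex_derive_ext (fun s => beta_primitive gam c s - beta_primitive gam c 0)).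
  { intros t; symmetry; now apply beta_eq. }
  auto_derive; repeat split; now apply ex_derive_beta_primitive.
- intros s; rewrite !beta_eq by easy; f_equal.
  unfold beta_primitive, hess; rewrite (alpha_periodic gam) by easy.
  now destruct (cycle_periodic _ _ hc s) as [-> ->].
Qed.

(** * Asymptotics *)

Lemma bigO_ext (es : R) (n : nat) (f g : R -> R -> R -> R) :
  (forall eps t s, 0 < eps <= es -> f eps t s = g eps t s) -> bigO es n f -> bigO es n g.
Proof. intros h [M hM]; exists M; intros eps he t s; rewrite <- h by easy; now apply hM. Qed.

Lemma bigO_plus (es : R) (n : nat) (f g : R -> R -> R -> R) :
  bigO es n f -> bigO es n g -> bigO es n (fun eps t s => f eps t s + g eps t s).
Proof.
intros [M hM] [N hN]; exists (M + N); intros eps he t s.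
apply Rle_trans with (1 := Rabs_triang _ _).
pose proof (hM eps he t s); pose proof (hN eps he t s); lra.
Qed.

Lemma bigO_mult (es : R) (n m : nat) (f g : R -> R -> R -> R) :
  bigO es n f -> bigO es m g -> bigO es (n + m) (fun eps t s => f eps t s * g eps t s).
Proof.
intros [M hM] [N hN]; exists (M * N); intros eps he t s.
rewrite Rabs_mult, pow_add.
replace (M * N * (eps ^ n * eps ^ m)) with (M * eps ^ n * (N * eps ^ m)) by ring.
apply Rmult_le_compat; auto using Rabs_pos.
Qed.

Lemma bigO_eps (es : R) : bigO es 1 (fun eps _ _ => eps).
Proof. exists 1; intros eps he _ _; rewrite Rabs_pos_eq; lra. Qed.

Lemma bigO_weaken (es : R) (n : nat) (f : R -> R -> R -> R) :
  bigO es (S n) f -> bigO es n f.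
Proof.
intros [M hM]; exists (Rabs M * es); intros eps he t s.
apply Rle_trans with (1 := hM eps he t s); simpl.
pose proof (Rle_abs M); pose proof (Rabs_pos M).
assert (0 <= eps ^ n) by (apply pow_le; lra).
replace (M * (eps * eps ^ n)) with (M * eps * eps ^ n) by ring.
apply Rmult_le_compat_r; [easy | nra].
Qed.

Lemma bigO_const (es k : R) : bigO es 0 (fun _ _ _ => k).
Proof. exists (Rabs k); intros eps he t s; simpl; lra. Qed.

Lemma bigO_bounded (es : R) (f : R -> R -> R) :
  bounded_2d f -> bigO es 0 (fun _ t s => f t s).
Proof. intros [M hM]; exists M; intros eps he t s; simpl; rewrite Rmult_1_r; apply hM. Qed.

(** With [r = g eps + V eps^2], the part of [beta r^2] beyond [beta g^2 eps^2] is
    [beta (2 g V + eps V^2) eps^3]. As [V] enters at order [eps^2], replacing it by [w] costs one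
    more order. *)
Lemma rho_of_expansion (es gam : R) (c : cycle) (g V w : R -> R -> R -> R) :
  is_cycle gam c -> (forall v, alpha c v <> 0) ->
  bigO es 0 g -> bigO es 0 V -> bigO es 1 (fun eps t s => V eps t s - w eps t s) ->
  bigO es 3 (fun eps t s =>
    rho_of gam c (g eps t s * eps + V eps t s * eps ^ 2) s
    - / alpha c s * (g eps t s * eps + (w eps t s + beta gam c s * g eps t s ^ 2) * eps ^ 2)).
Proof.
intros hc ha hg hV hVw.
pose proof (bigO_bounded es _ (bounded_inv_alpha gam c hc ha)) as hal.
pose proof (bigO_bounded es _ (bounded_beta gam c hc ha)) as hbe.
pose proof (bigO_eps es) as he.
apply (bigO_ext es 3 (fun eps t s => / alpha c s * ((V eps t s - w eps t s) * (eps * eps)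
  + beta gam c s * (((2 * (g eps t s * V eps t s)) + eps * (V eps t s * V eps t s)) * (eps * (eps * eps)))))).
{ intros eps t s _; unfold rho_of; ring. }
assert (he2 := bigO_mult _ _ _ _ _ he he).
apply (bigO_mult es 0 3 _ _ hal), bigO_plus.
- exact (bigO_mult es 1 2 _ _ hVw he2).
- apply (bigO_mult es 0 3 _ _ hbe).
  refine (bigO_mult es 0 3 _ _ _ (bigO_mult es 1 2 _ _ he he2)).
  apply bigO_plus.
  + exact (bigO_mult es 0 0 _ _ (bigO_const es 2) (bigO_mult es 0 0 _ _ hg hV)).
  + apply bigO_weaken, (bigO_mult es 1 0 _ _ he), (bigO_mult es 0 0 _ _ hV hV).
Qed.

Lemma bigO_inverse_shift (es : R) (De Om : R -> R -> R -> R) :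
  inverse_shift es De Om -> (exists M, forall eps, 0 < eps <= es -> forall t s, Rabs (De t s eps) <= M) ->
  bigO es 0 (fun eps t s => Om t s eps).
Proof.
intros hi [M hM]; exists M; intros eps he t s; simpl; rewrite Rmult_1_r.
pose proof (proj2 (hi eps he t s (s + Om t s eps * eps)) eq_refl) as e.
replace (Om t s eps) with (- De t (s + Om t s eps * eps) eps).
- rewrite Rabs_Ropp; now apply hM.
- apply (Rmult_eq_reg_r eps); lra.
Qed.

Lemma bigO_surface_shift (es : R) (A Om : R -> R -> R -> R) :
  (exists L, forall eps, 0 < eps <= es -> forall t s1 s2,
    Rabs (A eps t s1 - A eps t s2) <= L * Rabs (s1 - s2)) ->
  bigO es 0 (fun eps t s => Om t s eps) ->
  bigO es 1 (fun eps t s => A eps t (s + Om t s eps * eps) - A eps t s).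
Proof.
intros [L hL] [M hM]; exists (Rabs L * M); intros eps he t s.
apply Rle_trans with (1 := hL eps he t _ _).
replace (s + Om t s eps * eps - s) with (Om t s eps * eps) by ring.
rewrite Rabs_mult, (Rabs_pos_eq eps) by lra.
pose proof (hM eps he t s) as h; simpl in h; rewrite Rmult_1_r in h.
pose proof (Rabs_pos (Om t s eps)); pose proof (Rle_abs L); pose proof (Rabs_pos L).
simpl; rewrite Rmult_1_r, <- Rmult_assoc; apply Rmult_le_compat_r; [lra|].
apply Rle_trans with (Rabs L * Rabs (Om t s eps)).
- now apply Rmult_le_compat_r.
- now apply Rmult_le_compat_l.
Qed.

(** Serves both values of nu: [g + g' eps] stands for G, [f + f' eps] for F and [h] for H. The term
    [g'] moves up to order [eps^2], while [h] and [f'] first contribute at order [eps^3]. *)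
Lemma Upsilon_expansion (es gam : R) (c : cycle)
    (g g' h f f' A Om : R -> R -> R -> R) :
  is_cycle gam c -> (forall v, alpha c v <> 0) ->
  bigO es 0 g -> bigO es 0 g' -> bigO es 0 h -> bigO es 0 f -> bigO es 0 f' ->
  bigO es 0 A ->
  bigO es 1 (fun eps t s => A eps t (s + Om t s eps * eps) - A eps t s) ->
  bigO es 3 (fun eps t s =>
    rho_of gam c
      ((g eps t s + g' eps t s * eps) * eps
       + (A eps t (s + Om t s eps * eps) * (1 + h eps t s * eps)
          + (f eps t s + f' eps t s * eps)) * eps ^ 2) s
    - / alpha c s * (g eps t s * eps
       + (A eps t s + g' eps t s + f eps t s + beta gam c s * g eps t s ^ 2) * eps ^ 2)).
Proof.
intros hc ha hg hg' hh hf hf' hA hD.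
pose proof (bigO_eps es) as he.
set (A' := fun eps t s => A eps t (s + Om t s eps * eps)).
set (w := fun eps t s => A eps t s + g' eps t s + f eps t s).
set (V := fun eps t s => g' eps t s + (A' eps t s * (1 + h eps t s * eps)
  + (f eps t s + f' eps t s * eps))).
assert (hA' : bigO es 0 A').
{ apply (bigO_ext es 0 (fun eps t s => A eps t s
    + (A eps t (s + Om t s eps * eps) - A eps t s))); [intros; unfold A'; ring|].
  now apply bigO_plus; [|apply bigO_weaken]. }
assert (hVw : bigO es 1 (fun eps t s => V eps t s - w eps t s)).
{ apply (bigO_ext es 1 (fun eps t s => (A eps t (s + Om t s eps * eps) - A eps t s)
    + (A' eps t s * h eps t s + f' eps t s) * eps)).
  { intros; unfold V, w, A'; ring. }
  apply bigO_plus; [easy|].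
  refine (bigO_mult es 0 1 _ _ _ he).
  apply bigO_plus; [exact (bigO_mult es 0 0 _ _ hA' hh) | easy]. }
assert (hV : bigO es 0 V).
{ apply (bigO_ext es 0 (fun eps t s => w eps t s + (V eps t s - w eps t s))); [intros; ring|].
  apply bigO_plus; [|now apply bigO_weaken].
  unfold w; repeat apply bigO_plus; easy. }
apply (bigO_ext es 3 (fun eps t s =>
    rho_of gam c (g eps t s * eps + V eps t s * eps ^ 2) s
    - / alpha c s * (g eps t s * eps + (w eps t s + beta gam c s * g eps t s ^ 2) * eps ^ 2))).
{ intros eps t s _; unfold V, w, A'; f_equal; f_equal; ring. }
now apply rho_of_expansion.
Qed.

(** * Bounds on the averaging functions and the two expansions *)

Lemma bounded_C1 (T om : R) (f : R -> R -> R) :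
  0 < T -> 0 < om -> doubly_periodic_C1 T om f -> bounded_2d f.
Proof.
intros hT hom [hp hr]; apply (bounded_of_periodic_2d T om); try easy.
intros t s; apply hr.
Qed.

Lemma bounded_hat (om : R) (rhs f : R -> R) :
  0 < om -> solves_hat1 om rhs f -> bounded_2d (fun _ s => f s).
Proof.
intros hom [hp [_ hd]]; apply (bounded_of_periodic om); try easy.
intros s; exists (rhs s); apply hd.
Qed.

Theorem mainTheorem7
    (gam T eps0 sigma : R)
    (hgam : 0 < gam <= 1) (hT : 0 < T) (heps0 : 0 < eps0)
    (hsigma : sqrt (1 + / sqrt gam) < sigma)
    (c : cycle) (hc : is_cycle gam c) :
  (* nu = 0 *)
  (forall (X0 X1 Y0 Y1 : R -> R -> R -> R) (X2 Y2 : R -> R -> R -> R -> R)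
      (gt ht ft dt : R -> R -> R)
      (es : R) (Om A : R -> R -> R -> R),
    real_analytic T sigma X0 -> real_analytic T sigma Y0 ->
    real_analytic T sigma X1 -> real_analytic T sigma Y1 ->
    remainder_class 0 T sigma eps0 X2 -> remainder_class 0 T sigma eps0 Y2 ->
    averaging0 gam T c X0 Y0 X1 Y1 gt ht ft dt ->
    admissible0 gam T c X0 Y0 gt sigma ->
    0 < es <= eps0 ->
    inverse_shift es (comb0 dt) Om ->
    invariant_surface 0 gam sigma T c (field0 X0 X1 X2) (field0 Y0 Y1 Y2)
      (G0 gam T c X0 Y0 X1 Y1 gt) (comb0 ht) (comb0 ft) (comb0 dt) es A ->
    bigO es 3 (fun eps t phi =>
      Upsilon gam c (G0 gam T c X0 Y0 X1 Y1 gt) (comb0 ht) (comb0 ft) Om A eps t phi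
      - expansion0 gam c (gbar0 gam T c X0 Y0 X1 Y1 gt) gt ft A eps t phi)
    /\ bigO es 0 A)
  /\
  (* nu = 1 *)
  (forall (X0 Y0 : R -> R -> R -> R) (X1 Y1 : R -> R -> R -> R -> R)
      (gh hh fh dh : R -> R) (gt ht ft dt : R -> R -> R)
      (es : R) (Om A : R -> R -> R -> R),
    real_analytic T sigma X0 -> real_analytic T sigma Y0 ->
    remainder_class 1 T sigma eps0 X1 -> remainder_class 1 T sigma eps0 Y1 ->
    let X1_0 := fun t x y => X1 t x y 0 in
    let Y1_0 := fun t x y => Y1 t x y 0 in
    admissible1 gam T c X0 Y0 sigma ->
    averaging1 gam T c X0 Y0 X1_0 Y1_0 gh gt hh fh dh ht ft dt ->
    0 < es <= eps0 ->
    inverse_shift es (comb1 dh dt) Om ->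
    invariant_surface 1 gam sigma T c (field1 X0 X1) (field1 Y0 Y1)
      (G1 gam T c X0 Y0 X1_0 Y1_0 gh gt)
      (comb1 hh ht) (comb1 fh ft) (comb1 dh dt) es A ->
    bigO es 3 (fun eps t phi =>
      Upsilon gam c (G1 gam T c X0 Y0 X1_0 Y1_0 gh gt) (comb1 hh ht) (comb1 fh ft)
        Om A eps t phi
      - expansion1 gam c (gbar1 gam T c X0 Y0 X1_0 Y1_0 gh) gh gt fh A eps t phi)
    /\ bigO es 0 A).
Proof.
assert (hom := cycle_om _ _ hc).
split.
- intros X0 X1 Y0 Y1 X2 Y2 gt ht ft dt es Om A _ _ _ _ _ _
    [[hg _] [hh _] [hf _] [hd _]] [_ [hrange _]] hes hOm hA.
  assert (ha : forall v, alpha c v <> 0) by (intros; now apply (alpha_neq0 gam sigma)).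
  assert (bA : bigO es 0 A).
  { destruct (inv_bounded _ _ _ _ _ _ _ _ _ _ _ _ _ hA) as [M hM].
    exists M; intros eps he t s; simpl; rewrite Rmult_1_r; now apply hM. }
  apply (bounded_C1 T _ _ hT hom) in hg, hh, hf, hd.
  assert (bOm : bigO es 0 (fun eps t s => Om t s eps)).
  { apply (bigO_inverse_shift _ _ _ hOm).
    destruct hd as [M hM]; exists M; intros; apply hM. }
  split; [|easy].
  set (gb := gbar0 gam T c X0 Y0 X1 Y1 gt).
  (* For nu = 0 neither G nor F depends on [eps], so [g'] and [f'] are zero. *)
  refine (bigO_ext es 3 _ _ _ (Upsilon_expansion es gam c (fun _ t s => gb + gt t s)
    (fun _ _ _ => 0) (fun _ t s => ht t s) (fun _ t s => ft t s) (fun _ _ _ => 0)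
    A Om hc ha _ _ _ _ _ bA _)).
  + intros eps t s _; unfold Upsilon, expansion0, G0, comb0; fold gb.
    f_equal; [f_equal; ring | ring].
  + exact (bigO_plus es 0 _ _ (bigO_const es gb) (bigO_bounded es _ hg)).
  + apply bigO_const.
  + now apply bigO_bounded.
  + now apply bigO_bounded.
  + apply bigO_const.
  + apply bigO_surface_shift; [exact (inv_lipschitz _ _ _ _ _ _ _ _ _ _ _ _ _ hA) | easy].
- intros X0 Y0 X1 Y1 gh hh fh dh gt ht ft dt es Om A _ _ _ _ X1_0 Y1_0
    [_ [hrange _]] [hgh [hgt _] hhh [hht _] hfh [hft _] hdh [hdt _]] hes hOm hA.
  assert (ha : forall v, alpha c v <> 0) by (intros; now apply (alpha_neq0 gam sigma)).
  assert (bA : bigO es 0 A).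
  { destruct (inv_bounded _ _ _ _ _ _ _ _ _ _ _ _ _ hA) as [M hM].
    exists M; intros eps he t s; simpl; rewrite Rmult_1_r; now apply hM. }
  apply (bounded_C1 T _ _ hT hom) in hgt, hht, hft, hdt.
  apply (bounded_hat _ _ _ hom) in hgh, hhh, hfh, hdh.
  (* H and Delta enter only through a uniform bound, so their hat and tilde parts need not be
     separated. *)
  assert (bcomb : forall (u : R -> R) (v : R -> R -> R),
    bounded_2d (fun _ s => u s) -> bounded_2d v -> bigO es 0 (fun eps t s => comb1 u v t s eps)).
  { intros u v hu hv; unfold comb1; apply bigO_plus; [exact (bigO_bounded es _ hu)|].
    apply bigO_weaken, (bigO_mult es 0 1 _ _ (bigO_bounded es _ hv) (bigO_eps es)). }
  assert (bOm : bigO es 0 (fun eps t s => Om t s eps)).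
  { apply (bigO_inverse_shift _ _ _ hOm).
    destruct (bcomb _ _ hdh hdt) as [M hM]; exists M; intros eps he t s.
    pose proof (hM eps he t s) as h; simpl in h; lra. }
  split; [|easy].
  set (gb := gbar1 gam T c X0 Y0 X1_0 Y1_0 gh).
  (* Here [gt] is the [eps] coefficient of G and joins [fh] at order [eps^2]; [ft] is absorbed by
     the remainder. *)
  refine (bigO_ext es 3 _ _ _ (Upsilon_expansion es gam c (fun _ _ s => gb + gh s)
    (fun _ t s => gt t s) (fun eps t s => comb1 hh ht t s eps) (fun _ _ s => fh s)
    (fun _ t s => ft t s) A Om hc ha _ _ _ _ _ bA _)).
  + intros eps t s _; unfold Upsilon, expansion1, G1, comb1; fold gb.
    f_equal; ring.
  + exact (bigO_plus es 0 _ _ (bigO_const es gb) (bigO_bounded es _ hgh)).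
  + now apply bigO_bounded.
  + now apply bcomb.
  + exact (bigO_bounded es _ hfh).
  + now apply bigO_bounded.
  + apply bigO_surface_shift; [exact (inv_lipschitz _ _ _ _ _ _ _ _ _ _ _ _ _ hA) | easy].
Qed.
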